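(* Let $(K,\mathrm{val})$ be a complete algebraically closed non-archimedean field and let $A,B,C,D\in K$. If $\min\{\mathrm{val}(A),\mathrm{val}(B),\mathrm{val}(C),\mathrm{val}(D)\}<0$, then the parameter $(A,B,C,D)$ admits the Fatou domain; that is, $\mathcal{F}_{ABCD}\neq\varnothing$.
   Context: A non-archimedean field is a field $K$ with a nontrivial valuation $\mathrm{val}\colon K\to\mathbb{R}\cup\{\infty\}$ ($\mathrm{val}(x)=\infty$ iff $x=0$, $\mathrm{val}(xy)=\mathrm{val}(x)+\mathrm{val}(y)$, $\mathrm{val}(x+y)\ge\min\{\mathrm{val}(x),\mathrm{val}(y)\}$, and $\mathrm{val}(x)\neq0$ for some $x\in K^\times$). It is given the topology and uniform structure of the absolute value $|x|=e^{-\mathrm{val}(x)}$. The Markov surface is $S_{ABCD}\colon X_1^2+X_2^2+X_3^2+X_1X_2X_3=AX_1+BX_2+CX_3+D$, and $S_{ABCD}(K)\subset K^3$ has the induced topology and metric. The Vieta involutions are $s_1(X_1,X_2,X_3)=(-X_1-X_2X_3+A,X_2,X_3)$, $s_2(X_1,X_2,X_3)=(X_1,-X_2-X_1X_3+B,X_3)$, $s_3(X_1,X_2,X_3)=(X_1,X_2,-X_3-X_1X_2+C)$, and $\Gamma_{ABCD}=\langle s_1,s_2,s_3\rangle$. $\Gamma_{ABCD}$ forms a normal family on an open set $U\subset S_{ABCD}(K)$ if every sequence $(\gamma_n)$ in $\Gamma_{ABCD}$ has a subsequence $(\gamma_{n_k})$ whose restrictions $\gamma_{n_k}|_U$ are either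 (a) locally uniformly convergent to a continuous map on $U$, or (b) locally uniformly converging to infinity, i.e. for all compact subsets $V\subset U$ and $L\subset S_{ABCD}(K)$ we have $\gamma_{n_k}(V)\cap L=\varnothing$ for all but finitely many $k$. The Fatou domain $\mathcal{F}_{ABCD}$ is the set of $p\in S_{ABCD}(K)$ such that $\Gamma_{ABCD}$ forms a normal family on some open neighborhood of $p$. *)

(* Defs.v *)
From HB Require Import structures.
From mathcomp Require Import all_boot all_order all_algebra.
From mathcomp Require Import all_classical all_reals all_analysis.
From mathcomp Require Import ring.

Set Implicit Arguments.
Unset Strict Implicit.
Unset Printing Implicit Defensive.

Import Order.TTheory GRing.Theory Num.Theory.
Import numFieldNormedType.Exports.

Local Open Scope classical_set_scope.
Local Open Scope ring_scope.

(* [\bar R] also contains [-oo], which [val_neqNy] removes from the range. *)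
Record valuation (R : realType) (K : fieldType) := Valuation {
  val_fun :> K -> \bar R;
  val_neqNy : forall x, val_fun x != -oo%E;
  val_eqy : forall x, val_fun x = +oo%E <-> x = 0;
  val_mul : forall x y, val_fun (x * y) = (val_fun x + val_fun y)%E;
  val_add : forall x y,
    (Order.min (val_fun x) (val_fun y) <= val_fun (x + y)%R)%E;
  val_nontrivial : exists2 x : K, x != 0 & val_fun x != 0%E
}.

Section absolute_value.
Context {R : realType} {K : fieldType} (v : valuation R K).

Definition vabs (x : K) : R := fine (expeR (- v x)).

Lemma vabs0 : vabs 0 = 0.
Proof. by rewrite /vabs (val_eqy v 0).2. Qed.

Lemma vabs0_eq0 x : vabs x = 0 -> x = 0.
Proof.
move=> h; apply/(val_eqy v); move: h (val_neqNy v x); rewrite /vabs.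
by case: (v x) => [r| |] //= h _; move: (expR_gt0 (- r)); rewrite h ltxx.
Qed.

Lemma val1 : v 1 = 0%E.
Proof.
have := val_mul v 1 1; rewrite mulr1; have := val_neqNy v 1.
have := oner_neq0 K => /eqP /(contra_not (val_eqy v 1).1).
case: (v 1) => [r| |] // _ _ [] h; congr (_%:E).
by apply: (addrI r); rewrite addr0 -h.
Qed.

Lemma valN x : v (- x) = v x.
Proof.
suff h : v (- 1) = 0%E by rewrite -mulN1r val_mul h add0e.
have := val_mul v (- 1) (- 1); rewrite mulrNN mulr1 val1.
case: (v (- 1)) => [r| |] // [] /esym/eqP.
by rewrite -mulr2n mulrn_eq0 /= => /eqP ->.
Qed.

Lemma vabsN x : vabs (- x) = vabs x.
Proof. by rewrite /vabs valN. Qed.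

Lemma vabsD x y : vabs (x + y) <= vabs x + vabs y.
Proof.
have fin z : expeR (- v z) \is a fin_num.
  by case: (v z) (val_neqNy v z).
have ge0 z : 0 <= vabs z by rewrite fine_ge0 ?expeR_ge0.
suff : vabs (x + y) <= vabs x \/ vabs (x + y) <= vabs y.
  by case=> /le_trans; apply; rewrite ?lerDl ?lerDr.
have le z : (v z <= v (x + y)%R)%E -> vabs (x + y) <= vabs z.
  by move=> h; rewrite fine_le ?fin// ler_expeR leeN2.
have := val_add v x y; rewrite /Order.min.
by case: ifP => _ /le; [left|right].
Qed.

End absolute_value.

(* The field [K] carrying the metric [|x - y|] with [|x| = e^(- val x)]. *)
Definition valued (R : realType) (K : fieldType) (v : valuation R K) : Type :=
  K.

Section valued_metric.
Context (R : realType) (K : fieldType) (v : valuation R K).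

HB.instance Definition _ := GRing.Field.on (valued v).

Let dist (x y : valued v) : R := vabs v (x - y).

Let distxx x : dist x x = 0.
Proof. by rewrite /dist subrr vabs0. Qed.

Let dist_eq0 x y : dist x y = 0 -> x = y.
Proof. by move/vabs0_eq0/eqP; rewrite subr_eq0 => /eqP. Qed.

Let dist_sym x y : dist x y = dist y x.
Proof. by rewrite /dist -vabsN opprB. Qed.

Let dist_triangle y x z : dist x z <= dist x y + dist y z.
Proof. by rewrite /dist (le_trans _ (vabsD _ _ _))// addrA subrK. Qed.

HB.instance Definition _ := @isMetric.Build R (valued v) dist
  distxx dist_eq0 dist_sym dist_triangle.

End valued_metric.

Definition cauchy_complete (T : uniformType) : Prop :=
  forall F : set_system T, ProperFilter F -> cauchy F -> exists l : T, F --> l.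

Section markov_surface.
Context {K : fieldType} (A B C D : K).

Definition markov_surface : set (K * K * K) :=
  [set x | let: (x1, x2, x3) := x in
    x1 ^+ 2 + x2 ^+ 2 + x3 ^+ 2 + x1 * x2 * x3
      = A * x1 + B * x2 + C * x3 + D].

Definition vieta1 (x : K * K * K) : K * K * K :=
  let: (x1, x2, x3) := x in (- x1 - x2 * x3 + A, x2, x3).
Definition vieta2 (x : K * K * K) : K * K * K :=
  let: (x1, x2, x3) := x in (x1, - x2 - x1 * x3 + B, x3).
Definition vieta3 (x : K * K * K) : K * K * K :=
  let: (x1, x2, x3) := x in (x1, x2, - x3 - x1 * x2 + C).

Lemma vieta1_surface x : markov_surface x -> markov_surface (vieta1 x).
Proof.
case: x => [[x1 x2] x3]; rewrite /markov_surface /= => /eqP.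
rewrite -subr_eq0 => /eqP h; apply/eqP; rewrite -subr_eq0 -h.
by apply/eqP; ring.
Qed.

Lemma vieta2_surface x : markov_surface x -> markov_surface (vieta2 x).
Proof.
case: x => [[x1 x2] x3]; rewrite /markov_surface /= => /eqP.
rewrite -subr_eq0 => /eqP h; apply/eqP; rewrite -subr_eq0 -h.
by apply/eqP; ring.
Qed.

Lemma vieta3_surface x : markov_surface x -> markov_surface (vieta3 x).
Proof.
case: x => [[x1 x2] x3]; rewrite /markov_surface /= => /eqP.
rewrite -subr_eq0 => /eqP h; apply/eqP; rewrite -subr_eq0 -h.
by apply/eqP; ring.
Qed.

Definition restrict_surface (f : K * K * K -> K * K * K)
    (hf : forall x, markov_surface x -> markov_surface (f x))
    (x : markov_surface) : markov_surface :=
  SigSub (mem_set (hf (set_val x) (set_mem (valP x)))).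

Definition s1 := restrict_surface vieta1_surface.
Definition s2 := restrict_surface vieta2_surface.
Definition s3 := restrict_surface vieta3_surface.

End markov_surface.

Arguments s1 {K} A B C D.
Arguments s2 {K} A B C D.
Arguments s3 {K} A B C D.

(* The subgroup generated by [G], when [G] consists of bijections of [T]. *)
Inductive generated_group (T : Type) (G : set (T -> T)) : set (T -> T) :=
| generated_in f : G f -> generated_group G f
| generated_id : generated_group G id
| generated_comp f g :
    generated_group G f -> generated_group G g -> generated_group G (f \o g)
| generated_inv f g :
    generated_group G f -> cancel f g -> cancel g f -> generated_group G g.

Definition Gamma (K : fieldType) (A B C D : K) :
    set (markov_surface A B C D -> markov_surface A B C D) :=
  generated_group [set f | [\/ f = s1 A B C D, f = s2 A B C D | f = s3 A B C D]].

Arguments Gamma {K} A B C D.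

Section normal_family.
Context {X : uniformType}.

(* For open [U], only the values of [g] on [U] matter. *)
Definition locally_uniform_cvg (U : set X) (f : nat -> X -> X) (g : X -> X) :=
  forall x, U x -> exists2 W, nbhs x W & {uniform W `&` U, f @ \oo --> g}.

Definition locally_uniform_cvg_infty (U : set X) (f : nat -> X -> X) :=
  forall V L : set X, V `<=` U -> compact V -> compact L ->
    \forall n \near \oo, (f n @` V) `&` L = set0.

Definition normal_family (G : set (X -> X)) (U : set X) :=
  forall f : nat -> X -> X, (forall n, G (f n)) ->
    exists k : nat -> nat, {homo k : m n / (m < n)%N} /\
      ((exists g : X -> X, {within U, continuous g} /\
          locally_uniform_cvg U (f \o k) g) \/
       locally_uniform_cvg_infty U (f \o k)).

End normal_family.

Definition Fatou (R : realType) (K : fieldType) (v : valuation R K)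
    (A B C D : valued v) : set (markov_surface A B C D) :=
  [set p | exists U, [/\ open U, U p & normal_family (Gamma A B C D) U]].

Arguments Fatou {R K} v A B C D.

(* Main.v *)
(* Write |.| for the absolute value.  If (x, y, z) has coordinates of absolute
   value > 1, |yz| >= |A|, |xz| dominates |y| and |B|, and |xy| dominates |z| and
   |C|, then s_2 replaces y by a coordinate of absolute value |xz|, and the
   condition is reproduced with the new y in the role of x.  Hence every further
   step of a reduced word multiplies the last modified coordinate by a factor
   bounded away from 1, and the images of the point under long words leave every
   compact set.  Since absolute values are locally constant away from 0, this
   happens uniformly near the point, so a sequence in Gamma either has word
   lengths tending to infinity and escapes, or has a constant subsequence.

   It remains to find a point p and an index e such that both p and s_e(p) satisfy
   the condition with the e-th coordinate in the role of x.  By cyclic symmetry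
   let |A| be maximal among |A|, |B|, |C|, and e = 1.  If |A| > 1 and
   |D| < |A|^2, take y = us and z = s/u with s^2 = A and u a generic unit; the
   equation becomes x^2 = -(y^2 + z^2 - By - Cz - D) and s_1 maps x to -x.
   Otherwise |A|^3 < |D|^2, and y = z = t with t^3 = D works with any solution
   x. *)
Require Import Defs.
From mathcomp Require Import all_boot all_order all_algebra.
From mathcomp Require Import all_classical all_reals all_analysis.
From mathcomp Require Import ring lra.

Set Implicit Arguments.
Unset Strict Implicit.
Unset Printing Implicit Defensive.

Import Order.TTheory GRing.Theory Num.Theory.
Import numFieldNormedType.Exports.

Local Open Scope classical_set_scope.
Local Open Scope ring_scope.

(** * Ultrametric absolute values *)

Section absolute_value.
Context {R : realType} {K : fieldType} (v : valuation R K).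
Local Notation av := (vabs v).

Lemma vabs_ge0 x : 0 <= av x.
Proof. by rewrite fine_ge0 ?expeR_ge0. Qed.

Lemma vabs_gt0 x : (0 < av x) = (x != 0).
Proof.
rewrite lt_neqAle vabs_ge0 andbT eq_sym; congr (~~ _).
by apply/eqP/eqP => [/vabs0_eq0|->]; rewrite ?vabs0.
Qed.

Lemma vabsM x y : av (x * y) = av x * av y.
Proof.
rewrite /vabs val_mul; move: (val_neqNy v x) (val_neqNy v y).
by case: (v x) (v y) => [r| |] [s| |] //= _ _; rewrite ?mulr0 ?mul0r//
  opprD expRD.
Qed.

Lemma vabs1 : av 1 = 1.
Proof. by rewrite /vabs Defs.val1 /= oppr0 expR0. Qed.

Lemma vabsX x n : av (x ^+ n) = av x ^+ n.
Proof. by elim: n => [|n ih]; rewrite ?vabs1// !exprS vabsM ih. Qed.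

Lemma vabsV x : av (x^-1) = (av x)^-1.
Proof.
have [->|x0] := eqVneq x 0; first by rewrite invr0 vabs0 invr0.
apply: (@mulfI _ (av x)); first by rewrite gt_eqF ?vabs_gt0.
by rewrite -vabsM !divff ?vabs1// gt_eqF ?vabs_gt0.
Qed.

Lemma vabsD_le x y e : av x <= e -> av y <= e -> av (x + y) <= e.
Proof.
have fin z : expeR (- v z) \is a fin_num.
  by case: (v z) (val_neqNy v z).
have le z : (v z <= v (x + y)%R)%E -> av (x + y) <= av z.
  by move=> h; rewrite fine_le ?fin// lee_expeR leeN2.
have := val_add v x y; rewrite /Order.min.
by case: ifP => _ /le h ? ?; apply: (le_trans h).
Qed.

Lemma vabsD_lt x y e : av x < e -> av y < e -> av (x + y) < e.
Proof.
move=> xe ye; apply: (@le_lt_trans _ _ (Order.max (av x) (av y))).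
  by apply: vabsD_le; rewrite le_max lexx ?orbT.
by rewrite gt_max xe.
Qed.

Lemma vabsD_eq x y : av y < av x -> av (x + y) = av x.
Proof.
move=> yx; apply/eqP; rewrite eq_le vabsD_le ?lexx ?(ltW yx)//= leNgt.
apply/negP => h.
by have := @vabsD_lt _ (- y) _ h; rewrite vabsN addrK ltxx => /(_ yx).
Qed.

Lemma vabs_gt1 x : (1 < av x) = (v x < 0)%E.
Proof.
rewrite /vabs; case: (v x) (val_neqNy v x) => [r| |] //= _.
  by rewrite -expR0 ltr_expR lte_fin oppr_gt0.
by rewrite ltr10.
Qed.

Lemma vabs_sum_le (I : Type) (s : seq I) (P : pred I) (F : I -> K) (e : R) :
  0 <= e -> (forall i, P i -> av (F i) <= e) -> av (\sum_(i <- s | P i) F i) <= e.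
Proof.
move=> e0 Fe; elim/big_ind: _ => //; first by rewrite vabs0.
by move=> x y; exact: vabsD_le.
Qed.

Lemma vabs_prod (I : Type) (s : seq I) (P : pred I) (F : I -> K) :
  av (\prod_(i <- s | P i) F i) = \prod_(i <- s | P i) av (F i).
Proof. exact: (big_morph _ vabsM vabs1). Qed.

End absolute_value.

(** * Gauss norms of polynomials *)

(** A unit [u] not congruent to any integral root of [p] gives [|u - a| = max(1, |a|)] for every
    root [a], which is the Gauss norm of ['X - a%:P]. Coefficient bounds multiply by the ultrametric
    inequality, so the factors can be treated one by one. *)
Lemma coef_vabs_le (R : realType) (K : closedFieldType) (v : valuation R K)
    (p : {poly K}) :
  exists2 u, vabs v u = 1 & forall k, vabs v p`_k <= vabs v p.[u].
Proof.
have [r pE] := closed_field_poly_normal p.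
(* The added root 0 makes [u] itself a unit and keeps the product nonconstant when no root is
   integral. *)
pose r1 := 0 :: [seq a <- r | vabs v a <= 1].
(* Euclid: the product of [u - a] over [0] and the integral roots [a] is [1];
   every factor is integral, so every factor is a unit. *)
have [u u1] : exists u, \prod_(a <- r1) (u - a) = 1.
  have /closed_rootP[u] : size (\prod_(a <- r1) ('X - a%:P) - 1) != 1%N.
    by rewrite size_polyDl ?size_prod_XsubC// size_polyN size_poly1.
  rewrite /root hornerD hornerN hornerC subr_eq0 horner_prod => /eqP h.
  by exists u; rewrite -[RHS]h; apply: eq_bigr => a _; rewrite hornerXsubC.
have prod1 : \prod_(a <- r1) vabs v (u - a) = 1.
  by rewrite -vabs_prod u1 vabs1.
have r1P a : a \in r1 -> vabs v a <= 1.
  by rewrite inE mem_filter => /predU1P[->|/andP[]//]; rewrite vabs0 ler01.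
(* If [|u| > 1], every factor [u - a] has absolute value [|u|], and the product could not be 1. *)
have ule1 : vabs v u <= 1.
  rewrite leNgt; apply/negP => ugt1; have := ugt1.
  rewrite -[X in X < _]prod1 big_cons subr0.
  rewrite -subr_lt0 -[X in _ - X]mulr1 -mulrBr pmulr_rlt0 ?(lt_trans ltr01)//.
  rewrite subr_lt0 ltNge big_seq; apply/negP/negPn.
  elim/big_ind: _ => // [x y|a]; first exact: mulr_ege1.
  rewrite mem_filter => /andP[a1 _].
  by rewrite vabsD_eq ?(ltW ugt1)// vabsN (le_lt_trans a1).
have uaE a : a \in r1 -> vabs v (u - a) = 1.
  move=> ar; apply/eqP; rewrite eq_le vabsD_le ?vabsN ?ule1 ?r1P//=.
  rewrite -{1}prod1 (perm_big _ (perm_to_rem ar)) big_cons ler_piMr ?vabs_ge0//.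
  rewrite big_seq prodr_ile1// => b /mem_rem/r1P b1.
  by rewrite vabs_ge0 vabsD_le ?vabsN.
have uE : vabs v u = 1 by have := uaE 0 (mem_head _ _); rewrite subr0.
exists u => //.
have factor a : a \in r -> vabs v (u - a) = Order.max 1 (vabs v a).
  have [a1 ar|a1 _] := leP (vabs v a) 1.
    by apply: uaE; rewrite inE mem_filter a1 ar orbT.
  by rewrite addrC vabsD_eq ?vabsN ?uE.
suff h k : vabs v (\prod_(z <- r) ('X - z%:P))`_k
    <= vabs v (\prod_(z <- r) ('X - z%:P)).[u].
  by move=> k; rewrite pE coefZ hornerZ !vabsM ler_wpM2l ?vabs_ge0.
rewrite big_seq; elim/big_ind: _ k => [k|p1 p2 h1 h2 k|a ar k].
- by rewrite hornerC vabs1 coefC; case: ifP; rewrite ?vabs1 ?vabs0.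
- rewrite hornerM vabsM coefM vabs_sum_le ?mulr_ge0 ?vabs_ge0// => i _.
  by rewrite vabsM ler_pM ?vabs_ge0.
- rewrite hornerXsubC factor// coefB coefX coefC.
  apply: vabsD_le; first by case: eqP; rewrite ?vabs1 ?vabs0 le_max ?lexx ?ler01.
  by rewrite vabsN; case: eqP; rewrite ?vabs0 le_max ?lexx ?orbT ?ler01.
Qed.

(** * The growth condition and its propagation *)

(* [x] plays the role of the coordinate modified last; [b] and [c] are the
   linear coefficients in the involutions of [y] and [z]. *)
Definition growing (R : realType) (K : fieldType) (v : valuation R K) (rho : R)
    (x y z a b c : K) : Prop :=
  [/\ [/\ rho <= vabs v x, rho <= vabs v y & rho <= vabs v z],
      vabs v a <= vabs v y * vabs v z,
      vabs v y < vabs v x * vabs v z /\ vabs v b < vabs v x * vabs v z &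
      vabs v z < vabs v x * vabs v y /\ vabs v c < vabs v x * vabs v y].

Section growing.
Context {R : realType} {K : fieldType} (v : valuation R K) (rho : R).

Lemma growingC x y z a b c :
  growing v rho x y z a b c -> growing v rho x z y a c b.
Proof. by move=> [[xr yr zr] yza yb zc]; split; rewrite // mulrC. Qed.

Lemma vabs_vieta (x y z b : K) :
  vabs v y < vabs v x * vabs v z -> vabs v b < vabs v x * vabs v z ->
  vabs v (- y - x * z + b) = vabs v x * vabs v z.
Proof.
rewrite -!vabsM => yxz bxz; rewrite -[- y - _]addrC -addrA vabsD_eq vabsN//.
by rewrite vabsD_lt// vabsN.
Qed.

(** The term [x * z] dominates, so [|y'| = |x||z|]. The strict bound on [b] becomes the weak one
    required of the new leading coefficient, while [|a| <= |y||z|] becomes strict because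
    [|y| < |y'|]. *)
Lemma growing_vieta x y z a b c (y' := - y - x * z + b) :
  1 < rho -> growing v rho x y z a b c ->
  growing v rho y' z x b c a /\ rho * vabs v x <= vabs v y'.
Proof.
move=> rho1 [[xr yr zr] yza [yxz bxz] [zxy cxy]].
have y'E : vabs v y' = vabs v x * vabs v z by exact: vabs_vieta.
have b0 : 0 <= vabs v b by exact: vabs_ge0.
rewrite /growing y'E.
move: (vabs v x) (vabs v y) (vabs v z) (vabs v a) (vabs v b) (vabs v c)
  xr yr zr yza yxz bxz zxy cxy b0
  => X Y Z a1 b1 c1 xr yr zr yza yxz bxz zxy cxy b0.
have X1 : 1 < X by lra.
have Z1 : 1 < Z by lra.
have XZX : rho * X <= X * Z by nra.
have X_XZ : X < X * Z by nra.
have XZ_XZZ : X * Z < X * Z * Z by rewrite ltr_pMr //; lra.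
have YZ_XZZ : Y * Z < X * Z * Z by rewrite ltr_pM2r //; lra.
have XY_XZX : X * Y < X * Z * X by rewrite [X * Y]mulrC ltr_pM2r //; lra.
have Z_XZX : Z < X * Z * X by nra.
split=> //; rewrite [Z * X]mulrC.
by split; [split|..]; try split; lra.
Qed.

End growing.

(** * Starting points on the Markov surface *)

Section markov_point.
Context {R : realType} {K : closedFieldType} (v : valuation R K).
Local Notation av := (vabs v).

Let pdeg2_root (b c : K) : exists x, x ^+ 2 + b * x + c = 0.
Proof.
have /closed_rootP[x /eqP] : size ('X^2 + (b *: 'X + c%:P)) != 1%N.
  rewrite size_polyDl size_polyXn// ltnS (leq_trans (size_polyD _ _))// geq_max.
  rewrite (leq_trans (size_scale_leq _ _)) ?size_polyX//.
  by rewrite (leq_trans (size_polyC_leq1 _)).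
by rewrite !hornerE; exists x.
Qed.

Lemma growing_point_linear (A B C D : K) :
  1 < av A -> av B <= av A -> av C <= av A -> av D < av A ^+ 2 ->
  exists rho x y z, [/\ 1 < rho, markov_surface A B C D (x, y, z),
    growing v rho x y z A B C &
    growing v rho (- x - y * z + A) y z A B C].
Proof.
move=> A1 BA CA DA.
have [s sA] : exists s, s ^+ 2 = A.
  by have [s] := pdeg2_root 0 (- A); rewrite mul0r addr0 => /subr0_eq; exists s.
(* This is [u ^+ 2 * P] below, expanded in [u] with [s ^+ 2 = A]. For the chosen unit, [|P| = |x|^2]
   bounds every coefficient: the constant term yields [|s| <= |x|], the odd ones bound [|B||s|] and
   [|C||s|]. *)
pose p : {poly K} := Poly [:: A; - (C * s); - D; - (B * s); A].
have [u u1 pu] := coef_vabs_le v p.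
have u0 : u != 0 by rewrite -(vabs_gt0 v) u1.
pose y := u * s; pose z := s / u.
pose P := y ^+ 2 + z ^+ 2 - B * y - C * z - D.
have PE : p.[u] = u ^+ 2 * P.
  by rewrite horner_Poly /= /P /y /z -sA; field.
have [x xP] := pdeg2_root 0 P; rewrite mul0r addr0 in xP.
have yzA : y * z = A by rewrite -sA /y /z; field.
pose S := av s.
have AS : av A = S ^+ 2 by rewrite -sA vabsX.
have yS : av y = S by rewrite vabsM u1 mul1r.
have zS : av z = S by rewrite vabsM vabsV u1 invr1 mulr1.
clearbody y z.
have S0 : 0 <= S by exact: vabs_ge0.
have S1 : 1 < S by rewrite AS in A1; nra.
have xPE : av P = av x ^+ 2.
  by move/eqP: xP; rewrite addrC addr_eq0 => /eqP ->; rewrite vabsN vabsX.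
have le_x2 k : av p`_k <= av x ^+ 2.
  by rewrite -xPE (le_trans (pu k))// PE vabsM vabsX u1 expr1n mul1r.
have := (le_x2 0%N, le_x2 1%N, le_x2 2%N, le_x2 3%N).
rewrite !coef_Poly /= !vabsN !vabsM -/S => -[[[Ax Cx] _] Bx].
rewrite AS in Ax BA CA DA; rewrite -exprM in DA.
have S24 : S ^+ 2 < S ^+ 4 by rewrite ltr_eXn2l.
have S34 : S ^+ 2 * S < S ^+ 4 by rewrite -exprSr ltr_eXn2l.
(* All terms of [P] are below [|A|^2 = S ^+ 4], the one in [D] by hypothesis. Hence [|x| < S ^+ 2],
   which turns [|d| S <= |x|^2] into [|d| < |x| S]. *)
have xlt : av x ^+ 2 < S ^+ 4.
  have lin (d : K) : av d <= S ^+ 2 -> av d * S < S ^+ 4.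
    by move=> dS; apply: le_lt_trans S34; rewrite ler_wpM2r.
  by rewrite -xPE /P !vabsD_lt ?vabsN ?vabsM ?vabsX ?yS ?zS ?S24 ?lin.
have x0 : 0 <= av x by exact: vabs_ge0.
have Sx : S <= av x by rewrite -(@ler_pXn2r _ 2) ?nnegrE.
have xS : av x < S ^+ 2 by rewrite -(@ltr_pXn2r _ 2) ?nnegrE ?sqr_ge0// -exprM.
have small (d : K) : av d * S <= av x ^+ 2 -> av d < av x * S.
  by move=> dx; rewrite -(@ltr_pM2r _ S) ?(lt_trans ltr01)//; nra.
have x'E : - x - y * z + A = - x by rewrite yzA subrK.
exists S, x, y, z; split => //; last rewrite x'E.
- by apply/eqP; rewrite /= -subr_eq0 -mulrA yzA -xP /P; apply/eqP; ring.
- by split; rewrite ?yS ?zS ?AS ?expr2 ?lexx//; split; rewrite ?small//; nra.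
- by split; rewrite ?vabsN ?yS ?zS ?AS ?expr2 ?lexx//; split; rewrite ?small//; nra.
Qed.

(** With [y = z = t] and [r = |t|], the point and its image under the first involution have as first
    coordinates the two roots of a quadratic whose product has absolute value [r ^+ 3] (from [D])
    and whose sum has absolute value [r ^+ 2] (from [t ^+ 2]). As in a Newton polygon, both roots
    are then at least [r] in absolute value. *)
Lemma growing_point_constant (A B C D : K) :
  1 < av D -> av A ^+ 3 < av D ^+ 2 -> av B <= av A -> av C <= av A ->
  exists rho x y z, [/\ 1 < rho, markov_surface A B C D (x, y, z),
    growing v rho x y z A B C &
    growing v rho (- x - y * z + A) y z A B C].
Proof.
move=> D1 AD BA CA.
have [t tD] : exists t, t ^+ 3 = D.
  have /closed_rootP[t] : size ('X^3 - D%:P) != 1%N by rewrite size_XnsubC.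
  by rewrite /root !hornerE subr_eq0 => /eqP; exists t.
pose r := av t.
have r0 : 0 <= r by exact: vabs_ge0.
have Dr : av D = r ^+ 3 by rewrite -tD vabsX.
rewrite Dr in D1 AD.
have r1 : 1 < r by rewrite ltNge; apply/negP => /(exprn_ile1 3 r0); rewrite leNgt D1.
have A0 : 0 <= av A by exact: vabs_ge0.
have Ar : av A < r ^+ 2.
  by rewrite -(@ltr_pXn2r _ 3) ?nnegrE ?sqr_ge0// -exprM mulnC exprM.
have Br := le_lt_trans BA Ar; have Cr := le_lt_trans CA Ar.
pose P := t ^+ 2 + t ^+ 2 - B * t - C * t - D.
have [x xP] := pdeg2_root (t * t - A) P.
have [x' x'E] : exists x', x' = - x - t * t + A by exists (- x - t * t + A).
have PE : av P = r ^+ 3.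
  rewrite /P addrC vabsD_eq vabsN Dr //.
  by rewrite !vabsD_lt ?vabsN ?vabsM ?vabsX -/r //; nra.
have xx' : av x * av x' = r ^+ 3.
  rewrite -PE -vabsM; congr av; apply/eqP; rewrite -subr_eq0 -oppr_eq0 -xP.
  by apply/eqP; rewrite x'E; ring.
have sum : av (x + x') = r ^+ 2.
  have -> : x + x' = - (t ^+ 2) + A by rewrite x'E; ring.
  by rewrite vabsD_eq vabsN vabsX.
(* If [|p| < r], the sum forces [|q| = r ^+ 2], and the product is then below [r ^+ 3]. *)
have large p q : av p * av q = r ^+ 3 -> av (p + q) = r ^+ 2 -> r <= av p.
  move=> pq pDq; rewrite leNgt; apply/negP => pr.
  have p0 : 0 <= av p by exact: vabs_ge0.
  have qp : av p < av q.
    by rewrite ltNge; apply/negP => /(vabsD_le (lexx _)); rewrite pDq; nra.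
  by move: pq; rewrite -(vabsD_eq qp) addrC pDq; nra.
have rx : r <= av x by exact: large sum.
have rx' : r <= av x' by apply: (large _ x); rewrite 1?mulrC 1?addrC.
exists r, x, t, t; split => //.
- by apply/eqP; rewrite /= -subr_eq0 -xP /P; apply/eqP; ring.
- by split; rewrite -/r ?lexx//; first nra; split; nra.
- by rewrite -x'E; split; rewrite -/r ?lexx//; first nra; split; nra.
Qed.

Lemma growing_point (A B C D : K) :
  av B <= av A -> av C <= av A -> 1 < av A \/ 1 < av D ->
  exists rho x y z, [/\ 1 < rho, markov_surface A B C D (x, y, z),
    growing v rho x y z A B C &
    growing v rho (- x - y * z + A) y z A B C].
Proof.
move=> ba ca gt1; have a0 := vabs_ge0 v A.
have [a1|a1] := leP (av A) 1.
  have D1 : 1 < av D by case: gt1 => //; rewrite ltNge a1.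
  apply: growing_point_constant => //.
  by apply: (@le_lt_trans _ _ 1); [exact: exprn_ile1|exact: exprn_egt1].
have [Da|aD] := ltP (av D) (av A ^+ 2); first exact: growing_point_linear.
have D1 : 1 < av D by apply: lt_le_trans aD; exact: exprn_egt1.
apply: growing_point_constant => //.
apply: (@lt_le_trans _ _ ((av A ^+ 2) ^+ 2)); first by rewrite -exprM ltr_eXn2l.
by rewrite ler_pXn2r ?nnegrE ?exprn_ge0// vabs_ge0.
Qed.

End markov_point.

(** * Reduced words and a normality criterion *)

Definition word_map (T I : Type) (s : I -> T -> T) (w : seq I) : T -> T :=
  foldr (fun i f => s i \o f) id w.

Definition reduced_word (I : eqType) (w : seq I) : bool :=
  sorted (fun i j => i != j) w.

Section generated_words.
Context (T : Type) (I : eqType) (s : I -> T -> T).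
Hypothesis sK : forall i, involutive (s i).

Lemma word_map_cat w1 w2 : word_map s (w1 ++ w2) = word_map s w1 \o word_map s w2.
Proof. by elim: w1 => //= i w1 ->. Qed.

Lemma word_map_revK w : cancel (word_map s w) (word_map s (rev w)).
Proof.
elim: w => //= i w ih x.
by rewrite rev_cons -cats1 word_map_cat /= sK ih.
Qed.

Lemma reduced_wordP w :
  exists2 w', reduced_word w' & word_map s w = word_map s w'.
Proof.
elim: w => [|i w [[|j w'] rw' wE]]; first by exists nil.
  by exists [:: i] => //=; rewrite wE.
have [eij|nij] := eqVneq i j; last first.
  by exists [:: i, j & w']; rewrite ?/reduced_word /= ?nij// wE.
exists w'; first exact: path_sorted rw'.
by rewrite /= wE -eij; apply/funext => x /=; rewrite sK.
Qed.

(** As the generators are involutions, reversing a word inverts it, and cancelling equal neighbours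
    makes it reduced. *)
Lemma generated_reduced_word f : generated_group [set g | exists i, g = s i] f ->
  exists2 w, reduced_word w & f = word_map s w.
Proof.
suff h : generated_group [set g | exists i, g = s i] f ->
    exists w, f = word_map s w.
  by move=> /h[w ->]; have [w' rw' ->] := reduced_wordP w; exists w'.
elim=> {f} [_ [i ->]||_ _ _ [w1 ->] _ [w2 ->]|_ g _ [w ->] fK gK].
- by exists [:: i].
- by exists nil.
- by exists (w1 ++ w2); rewrite word_map_cat.
- by exists (rev w); apply/funext => x; rewrite -[x in RHS]gK word_map_revK.
Qed.

End generated_words.

Lemma frequently_subsequence (P : nat -> Prop) :
  (forall m, exists2 n, (m <= n)%N & P n) ->
  exists k : nat -> nat, {homo k : m n / (m < n)%N} /\ forall n, P (k n).
Proof.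
move=> freq; have /choice[g gP] m : exists n, (m <= n)%N /\ P n.
  by have [n] := freq m; exists n.
exists (fun n => iter n (g \o succn) (g 0%N)); split.
  by apply: homo_ltn; [exact: ltn_trans|move=> n /=; exact: (gP _).1].
by case=> [|n] /=; exact: (gP _).2.
Qed.

Lemma normal_family_of_escape (X : uniformType) (I : finType) (s : I -> X -> X)
    (U : set X) :
  (forall i, involutive (s i)) -> (forall i, continuous (s i)) ->
  (forall L, compact L -> exists N, forall w x, reduced_word w ->
     (N <= size w)%N -> U x -> ~ L (word_map s w x)) ->
  normal_family (generated_group [set g | exists i, g = s i]) U.
Proof.
move=> sK sC escape f fG.
have /choice[w wP] n : exists w, reduced_word w /\ f n = word_map s w.
  by have [w] := generated_reduced_word sK (fG n); exists w.
have [[l freq]|/forallNP esc] := pselect (exists l, forall m, exists2 n,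
    (m <= n)%N & (size (w n) <= l)%N); last first.
  exists id; split => //; right => V L VU _ cL.
  have [N NP] := escape L cL; have /existsNP[m mP] := esc N.
  exists m => // n /= mn; rewrite -subset0 => _ [[x Vx <-]].
  rewrite /= (wP n).2; apply: NP; [exact: (wP n).1| |exact: VU].
  rewrite leqNgt; apply/negP => h; apply: mP; exists n => //; exact: ltnW.
(* Pigeonhole on the finite type of words of length at most [l]: if each stopped occurring from some
   index on, no short word could occur past the largest of these indices. *)
have [w0 w0P] : exists w0 : l.-bseq I, forall m, exists2 n, (m <= n)%N & w n = w0.
  apply: contrapT => /forallNP h.
  have /choice[N NP] (w0 : l.-bseq I) :
      exists m, forall n, (m <= n)%N -> w n <> w0.
    have /existsNP[m mP] := h w0; exists m => n mn wn; apply: mP; by exists n.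
  have [n mn nl] := freq (\max_w0 N w0).
  by apply: (NP (Bseq nl) n _ erefl); apply: leq_trans mn; exact: leq_bigmax.
have [k [kh kP]] := frequently_subsequence w0P.
have fk n : f (k n) = word_map s w0 by rewrite (wP _).2 kP.
exists k; split => //; left; exists (word_map s w0); split.
  apply: continuous_subspaceT; elim: (val w0) => [|i w1 ih] x /=; first exact: cvg_id.
  by apply: continuous_comp; [exact: ih|exact: sC].
move=> x _; exists setT; first exact: filterT.
by move=> P nP; exists 0%N => // n _ /=; rewrite fk; exact: (nbhs_singleton nP).
Qed.

(** * Topology of the valued field *)

Lemma continuous_pair (T U V : topologicalType) (f : T -> U) (g : T -> V) :
  continuous f -> continuous g -> continuous (fun x => (f x, g x)).
Proof. by move=> cf cg x; exact: cvg_pair (cf x) (cg x). Qed.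

Lemma continuous_proj3 (T U V : topologicalType) :
  [/\ continuous (fun x : T * U * V => x.1.1),
      continuous (fun x : T * U * V => x.1.2) &
      continuous (fun x : T * U * V => x.2)].
Proof.
split=> -[[x1 x2] x3]; last exact: cvg_snd.
  by apply: cvg_comp; [exact: cvg_fst|exact: cvg_fst].
by apply: cvg_comp; [exact: cvg_fst|exact: cvg_snd].
Qed.

Section valued_topology.
Context {R : realType} {K : fieldType} (v : valuation R K).
Local Notation V3 := (valued v * valued v * valued v)%type.

(** The ball of radius [|x|] works: on it [y - x] is strictly dominated by [x]. *)
Lemma near_vabs (x : valued v) :
  x != 0 -> \forall y \near x, vabs v y = vabs v x.
Proof.
rewrite -(vabs_gt0 v) => x0; apply/nbhs_ballP; exists (vabs v x) => //= y.
rewrite /ball /= => xy; rewrite -[y](subrK x) addrC.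
by rewrite vabsD_eq// -vabsN opprB.
Qed.

Lemma vabs_continuous : continuous (fun x : valued v => vabs v x).
Proof.
move=> x; apply/(@cvgrPdist_lt _ R^o _ _ (nbhs_filter (x : valued v))) => e e0.
apply/nbhs_ballP; exists e => //= y.
rewrite /ball /=; apply: le_lt_trans; rewrite ler_norml.
have := vabsD v (x - y) y; have := vabsD v (y - x) x.
by rewrite !subrK -[vabs v (y - x)]vabsN opprB; lra.
Qed.

Lemma valuedN_continuous : continuous (fun x : valued v => - x : valued v).
Proof.
move=> x; apply/(@cvg_ballP _ _ _ _ (nbhs_filter (x : valued v))) => e e0.
apply/nbhs_ballP; exists e => //= y.
by rewrite /ball /= -opprD vabsN.
Qed.

Lemma valuedD_continuous :
  continuous (fun x : valued v * valued v => x.1 + x.2 : valued v).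
Proof.
move=> [x1 x2].
apply/(@cvg_ballP _ _ _ _ (nbhs_filter ((x1, x2) : valued v * valued v))) => e e0.
apply/nbhs_ballP; exists e => //= -[y1 y2].
rewrite /ball /= /prod_ball /ball /= => -[xy1 xy2].
by rewrite opprD addrACA vabsD_lt.
Qed.

Lemma valuedM_continuous :
  continuous (fun x : valued v * valued v => x.1 * x.2 : valued v).
Proof.
move=> [x1 x2].
apply/(@cvg_ballP _ _ _ _ (nbhs_filter ((x1, x2) : valued v * valued v))) => e e0.
(* In the three-term expansion below, each term is a product of a factor below [e / m] and one below
   [m]; by the ultrametric inequality no splitting of [e] is needed. *)
pose m := 1 + vabs v x1 + vabs v x2.
have x1_ge0 := vabs_ge0 v x1; have x2_ge0 := vabs_ge0 v x2.
have m1 : 1 <= m by rewrite /m; lra.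
pose d := Num.min 1 (e / m).
have d0 : 0 < d by rewrite /d lt_min ltr01 divr_gt0//; lra.
apply/nbhs_ballP; exists d => //= -[y1 y2].
rewrite /ball /= /prod_ball /ball /= /d !lt_min
  => -[/andP[xy1 xy1m] /andP[xy2 xy2m]].
have -> : x1 * x2 - y1 * y2
    = (x1 - y1) * x2 + (x1 * (x2 - y2) - (x1 - y1) * (x2 - y2)) by ring.
have em0 : 0 < e / m by rewrite divr_gt0//; lra.
have emm : e / m * m = e by rewrite divfK// gt_eqF//; lra.
have d1_ge0 := vabs_ge0 v (x1 - y1); have d2_ge0 := vabs_ge0 v (x2 - y2).
rewrite !vabsD_lt ?vabsN ?vabsM// -emm.
- by rewrite ltr_pM// /m; lra.
- by rewrite mulrC ltr_pM// /m; lra.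
- by rewrite ltr_pM// (lt_le_trans xy2).
Qed.

Section cvg.
Context {T : Type} {F : set_system T} {FF : Filter F}.
Variables (f g : T -> valued v) (a b : valued v).

Lemma cvg_valuedN : f x @[x --> F] --> a ->
  (- f x : valued v) @[x --> F] --> (- a : valued v).
Proof.
move=> fa; apply: (@cvg_comp _ _ _ f (fun z => - z)); first exact: fa.
exact: valuedN_continuous.
Qed.

Hypotheses (fa : f x @[x --> F] --> a) (gb : g x @[x --> F] --> b).

Lemma cvg_valuedD : (f x + g x : valued v) @[x --> F] --> (a + b : valued v).
Proof.
apply: (@cvg_comp _ _ _ (fun y => (f y, g y)) (fun z => z.1 + z.2)).
  exact: cvg_pair fa gb.
exact: (@valuedD_continuous (a, b)).
Qed.

Lemma cvg_valuedM : (f x * g x : valued v) @[x --> F] --> (a * b : valued v).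
Proof.
apply: (@cvg_comp _ _ _ (fun y => (f y, g y)) (fun z => z.1 * z.2)).
  exact: cvg_pair fa gb.
exact: (@valuedM_continuous (a, b)).
Qed.

End cvg.

Lemma vieta_continuous (A B C : valued v) :
  [/\ continuous (vieta1 A : V3 -> V3),
      continuous (vieta2 B : V3 -> V3) &
      continuous (vieta3 C : V3 -> V3)].
Proof.
have [c1 c2 c3] := @continuous_proj3 (valued v) (valued v) (valued v).
have cV (f g h : V3 -> valued v) (a : valued v) :
    continuous f -> continuous g -> continuous h ->
    continuous (fun x => - f x - g x * h x + a : valued v).
  move=> cf cg ch x; apply: cvg_valuedD; last exact: cvg_cst.
  apply: cvg_valuedD; apply: cvg_valuedN; first exact: cf.
  by apply: cvg_valuedM; [exact: cg|exact: ch].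
split.
- have -> : vieta1 A = fun x => (- x.1.1 - x.1.2 * x.2 + A, x.1.2, x.2).
    by apply/funext => -[[x1 x2] x3].
  exact: continuous_pair (continuous_pair (cV _ _ _ A c1 c2 c3) c2) c3.
- have -> : vieta2 B = fun x => (x.1.1, - x.1.2 - x.1.1 * x.2 + B, x.2).
    by apply/funext => -[[x1 x2] x3].
  exact: continuous_pair (continuous_pair c1 (cV _ _ _ B c2 c1 c3)) c3.
- have -> : vieta3 C = fun x => (x.1.1, x.1.2, - x.2 - x.1.1 * x.1.2 + C).
    by apply/funext => -[[x1 x2] x3].
  exact: continuous_pair (continuous_pair c1 c2) (cV _ _ _ C c3 c1 c2).
Qed.

End valued_topology.

(** * Escape of orbits under the Vieta involutions *)

Lemma exists_expr_gt (R : realType) (r M : R) :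
  1 < r -> exists N, forall n, (N <= n)%N -> M < r ^+ n.
Proof.
move=> r1; have bern n : 1 + (r - 1) *+ n <= r ^+ n.
  elim: n => [|n ih]; first by rewrite mulr0n addr0.
  have ? : 0 <= (r - 1) *+ n by rewrite mulrn_wge0//; lra.
  by rewrite mulrSr exprS; nra.
exists (Num.bound `|M / (r - 1)|) => n Nn; apply: lt_le_trans (bern n).
have : M / (r - 1) < n%:R.
  apply: (le_lt_trans (ler_norm _)); apply: lt_le_trans (archi_boundP _) _ => //.
  by rewrite ler_nat.
rewrite ltr_pdivrMr; last lra.
by rewrite mulr_natl; lra.
Qed.

Section markov_dynamics.
Context {R : realType} {K : fieldType} (v : valuation R K).
Variables (A B C D : valued v).
Local Notation V3 := (valued v * valued v * valued v)%type.
Local Notation X := (markov_surface A B C D).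
Implicit Types (i j : 'I_3) (x : X) (rho : R).

Definition vieta i : X -> X := nth id [:: s1 A B C D; s2 A B C D; s3 A B C D] i.

Definition coord i x : valued v :=
  let: (x1, x2, x3) := set_val x in nth 0 [:: x1; x2; x3] i.

(** Coordinates and linear coefficients are rotated together, the [i]-th coming first, so [i] stands
    for the involution applied last. *)
Definition growing_at rho i x : Prop :=
  let: (x1, x2, x3) := set_val x in
  nth False [:: growing v rho x1 x2 x3 A B C; growing v rho x2 x3 x1 B C A;
                growing v rho x3 x1 x2 C A B] i.

Lemma GammaE : Gamma A B C D = generated_group [set g | exists i, g = vieta i].
Proof.
rewrite /Gamma; congr generated_group; apply/seteqP; split=> g /=.
  by case=> ->; [exists 0|exists 1|exists (inord 2); rewrite /vieta inordK].
by move=> [[[|[|[|//]]] ?] ->]; [exact: Or31|exact: Or32|exact: Or33].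
Qed.

Lemma vietaK i : involutive (vieta i).
Proof.
case: i => [[|[|[|//]]] ?] [[[x1 x2] x3] xS]; apply: eq_sig_hprop => //=;
  by congr (_, _, _); ring.
Qed.

Lemma continuous_restrict_surface
    (f : V3 -> V3)
    (hf : forall q, markov_surface A B C D q -> markov_surface A B C D (f q)) :
  continuous f -> continuous (restrict_surface hf).
Proof.
move=> cf; apply: continuous_comp_initial => x.
apply: (@continuous_comp _ _ _ (set_val : X -> _) f x); last exact: cf.
exact: initial_continuous.
Qed.

Lemma continuous_vieta i : continuous (vieta i).
Proof.
have [c1 c2 c3] := vieta_continuous A B C.
by case: i => [[|[|[|//]]] ?]; exact: continuous_restrict_surface.
Qed.

Lemma growing_at_ge rho i x : growing_at rho i x -> rho <= vabs v (coord i x).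
Proof.
rewrite /growing_at /coord; case: (set_val x) => -[x1 x2] x3.
by case: i => [[|[|[|//]]] ?] /= [[]].
Qed.

Lemma growing_at_vieta rho i j x : 1 < rho -> i != j -> growing_at rho i x ->
  growing_at rho j (vieta j x) /\
  rho * vabs v (coord i x) <= vabs v (coord j (vieta j x)).
Proof.
move=> rho1.
rewrite /growing_at /coord.
case: x => -[[x1 x2] x3] xS.
(* When [j] follows [i] cyclically this is [growing_vieta]; in the other three cases the last two
   coordinates are swapped before and after. *)
case: i => [[|[|[|//]]] ?]; case: j => [[|[|[|//]]] ?] //= _ h.
- exact: growing_vieta.
- by have [/growingC] := growing_vieta rho1 (growingC h).
- by have [/growingC] := growing_vieta rho1 (growingC h).
- by rewrite [x1 * x2]mulrC; exact: growing_vieta.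
- by rewrite [x2 * x3]mulrC; exact: growing_vieta.
- by rewrite [x1 * x3]mulrC; have [/growingC] := growing_vieta rho1 (growingC h).
Qed.

(** The rightmost letter acts first. If it is [e], the hypothesis on [vieta e x] starts the
    induction; otherwise the hypothesis on [x] does, through [growing_at_vieta]. Each later letter
    differs from its predecessor, so it gains a factor [rho]. *)
Lemma growing_at_word rho e i w x : 1 < rho ->
  growing_at rho e x -> growing_at rho e (vieta e x) -> reduced_word (i :: w) ->
  growing_at rho i (word_map vieta (i :: w) x) /\
  rho ^+ (size w).+1 <= vabs v (coord i (word_map vieta (i :: w) x)).
Proof.
move=> rho1 ge gse; elim: w i => [|j w ih] i.
  have [-> _|nei _] := eqVneq i e.
    by split=> //=; rewrite expr1; exact: growing_at_ge.
  rewrite eq_sym in nei; have [gi le_i] := growing_at_vieta rho1 nei ge.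
  by split=> //=; rewrite expr1 growing_at_ge.
rewrite /reduced_word /= => /andP[ij jw]; have [gj le_j] := ih j jw.
rewrite eq_sym in ij; have [gi le_i] := growing_at_vieta rho1 ij gj.
split=> //; apply: le_trans le_i.
by rewrite [_ ^+ (size (j :: w)).+1]exprS ler_pM2l// (lt_trans ltr01).
Qed.

Lemma continuous_coord i : continuous (coord i).
Proof.
have [c1 c2 c3] := @continuous_proj3 (valued v) (valued v) (valued v).
move=> x; apply: (@continuous_comp _ _ _ (set_val : X -> _)
  (fun q => let: (x1, x2, x3) := q in nth 0 [:: x1; x2; x3] i)).
  exact: initial_continuous.
have projE (f : V3 -> valued v) :
    continuous f ->
    (forall q, f q = let: (x1, x2, x3) := q in nth 0 [:: x1; x2; x3] i) ->
    {for set_val x, continuous (fun q =>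
      let: (x1, x2, x3) := q in nth 0 [:: x1; x2; x3] i)}.
  by move=> cf /funext <-; exact: cf.
by case: i projE => [[|[|[|//]]] ?] projE;
  [apply: projE c1 _|apply: projE c2 _|apply: projE c3 _] => -[[]].
Qed.

Lemma compact_coord_bounded (L : set X) : compact L ->
  exists M, forall x i, L x -> vabs v (coord i x) <= M.
Proof.
move=> cL; have /choice[M MP] i : exists M, forall x, L x -> vabs v (coord i x) <= M.
  have : bounded_set [set vabs v (coord i x) | x in L].
    apply: compact_bounded; apply: continuous_compact => //.
    apply: continuous_subspaceT => x.
    exact: (continuous_comp (@continuous_coord i x) (@vabs_continuous _ _ v _)).
  move=> [M [_ MP]]; exists (M + 1) => x Lx.
  apply: le_trans (ler_norm _) _; apply: (MP (M + 1)); last by exists x.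
  by rewrite ltrDl.
exists (\sum_i `|M i|) => x i Lx.
rewrite (bigD1 i)//= (le_trans (MP i x Lx))// (le_trans (ler_norm _))//.
by rewrite lerDl sumr_ge0.
Qed.

(** The condition involves the point only through the absolute values of its coordinates, which are
    nonzero and hence have locally constant absolute value. *)
Lemma near_growing_at rho i x : 0 < rho -> growing_at rho i x ->
  \forall y \near x, growing_at rho i y.
Proof.
move=> rho0 gx.
have near_coord j : \forall y \near x, vabs v (coord j y) = vabs v (coord j x).
  suff nz : coord j x != 0 by exact: (@continuous_coord j x _ (near_vabs nz)).
  rewrite -(vabs_gt0 v); apply: lt_le_trans rho0 _; move: gx.
  rewrite /growing_at /coord; case: (set_val x) => -[x1 x2] x3.
  by case: i => [[|[|[|//]]] ?]; case: j => [[|[|[|//]]] ?] /= [[]].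
move/(@filter_forall _ _ _ _ (nbhs_filter x)): near_coord.
apply: (@filterS _ _ (nbhs_filter x)) => y; move: gx; rewrite /growing_at /coord /growing.
case: (set_val x) => -[x1 x2] x3; case: (set_val y) => -[y1 y2] y3 gx xy.
have := xy (inord 2); have := xy 1; have := xy 0; rewrite /= inordK//= => e1 e2 e3.
by rewrite e1 e2 e3.
Qed.

Lemma Fatou_growing_at rho e x : 1 < rho ->
  growing_at rho e x -> growing_at rho e (vieta e x) -> Fatou v A B C D x.
Proof.
move=> rho1 gx gsx; have rho0 : 0 < rho by exact: lt_trans rho1.
pose U := [set y | growing_at rho e y /\ growing_at rho e (vieta e y)].
exists U^°; split; first exact: open_interior.
  apply: (@filterI _ _ (nbhs_filter x)); first exact: near_growing_at.
  by apply: (continuous_vieta (x := x)); exact: near_growing_at.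
rewrite GammaE; apply: normal_family_of_escape; [exact: vietaK|exact: continuous_vieta|].
move=> L /compact_coord_bounded[M MP].
have [N NP] := exists_expr_gt M rho1.
(* The successor rules out the empty word, which has no leading letter whose coordinate could exceed
   [M]. *)
exists N.+1 => -[//|i w] y rw Nw /interior_subset[gy gsy] Ly.
have [_] := growing_at_word rho1 gy gsy rw.
by apply/negP; rewrite -ltNge (le_lt_trans (MP _ i Ly))// NP// ltnW.
Qed.

End markov_dynamics.

(** * Nonemptiness of the Fatou domain, by cyclic symmetry *)

Theorem theorem2 (R : realType) (K : closedFieldType) (v : valuation R K)
    (hK : cauchy_complete (valued v)) (A B C D : K)
    (hmin : (Order.min (Order.min (v A) (v B)) (Order.min (v C) (v D)) < 0)%E) :
  Fatou v A B C D !=set0.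
Proof.
have gt1 : [\/ 1 < vabs v A, 1 < vabs v B, 1 < vabs v C | 1 < vabs v D].
  move: hmin; rewrite !gt_min -!(vabs_gt1 v).
  by case/orP=> /orP[]; [exact: Or41|exact: Or42|exact: Or43|exact: Or44].
have large a : vabs v A <= vabs v a -> vabs v B <= vabs v a ->
    vabs v C <= vabs v a -> 1 < vabs v a \/ 1 < vabs v D.
  by move=> Aa Ba Ca; case: gt1 => h; [left|left|left|right] => //;
    apply: lt_le_trans h _.
have Fatou_point e rho (x : markov_surface (A : valued v) B C D) :
    1 < rho -> growing_at rho e x -> growing_at rho e (vieta e x) ->
    Fatou v A B C D !=set0.
  by move=> rho1 gx gsx; exists x; exact: Fatou_growing_at gsx.
have [[BA CA]|[AB CB]|[AC BC]] : [\/ vabs v B <= vabs v A /\ vabs v C <= vabs v A,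
    vabs v A <= vabs v B /\ vabs v C <= vabs v B |
    vabs v A <= vabs v C /\ vabs v B <= vabs v C].
- have [BA|/ltW AB] := leP (vabs v B) (vabs v A).
    have [CA|/ltW AC] := leP (vabs v C) (vabs v A); first exact: Or31.
    by apply: Or33; split=> //; exact: le_trans AC.
  have [CB|/ltW BC] := leP (vabs v C) (vabs v B); first exact: Or32.
  by apply: Or33; split=> //; exact: le_trans BC.
- have [rho [x [y [z [rho1 xyzS g gs]]]]] :=
    growing_point (D := D) BA CA (large _ (lexx _) BA CA).
  by apply: (@Fatou_point 0 rho (SigSub (mem_set xyzS))).
- have [rho [x [y [z [rho1 xyzS g gs]]]]] :=
    growing_point (D := D) CB AB (large _ AB (lexx _) CB).
  (* The point was found for the parameters [(B, C, A)], so its coordinates are rotated back and [x]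
     becomes the second one. *)
  have zxyS : markov_surface A B C D (z, x, y).
    by move: xyzS => /= /eqP; rewrite -subr_eq0 => /eqP h;
      apply/eqP; rewrite -subr_eq0 -h; apply/eqP; ring.
  apply: (@Fatou_point 1 rho (SigSub (mem_set zxyS))) => //.
  by move: gs; rewrite [y * z]mulrC.
- have [rho [x [y [z [rho1 xyzS g gs]]]]] :=
    growing_point (D := D) AC BC (large _ AC BC (lexx _)).
  have yzxS : markov_surface A B C D (y, z, x).
    by move: xyzS => /= /eqP; rewrite -subr_eq0 => /eqP h;
      apply/eqP; rewrite -subr_eq0 -h; apply/eqP; ring.
  have i2 : (2 < 3)%N by [].
  by apply: (@Fatou_point (Ordinal i2) rho (SigSub (mem_set yzxS))).
Qed.
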